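(* Let $A=(a_1,a_2,a_3,a_4)\in (L_\infty(G;\mathbb{H}_{\mathbb{C}}))^4$ and let $\mathscr{K}_G^A(x,t;a)$ be the Vekua-Bergman kernel of $\mathfrak{V}_A^2(G;\mathbb{H}_{\mathbb{C}})$ with coefficient $a\in\mathbb{H}_{\mathbb{C}}$. Then: (i) $\mathscr{K}_G^A(\cdot,t;a)\in\mathfrak{V}_A^2(G;\mathbb{H}_{\mathbb{C}})$ for all $t\in G$ and $a\in\mathbb{H}_{\mathbb{C}}$. (ii) The following reproducing property holds: $$w(x)=\int_G\mathscr{K}_G^A(x,t;w(t))\,dV_t\qquad\text{for all } w\in\mathfrak{V}_A^2(G;\mathbb{H}_{\mathbb{C}}),\ x\in G.$$
   Context: Biquaternions: $\mathbb{H}_{\mathbb{C}}$ is the complex algebra of elements $p=p_0+\vec p$, $\vec p=\sum_{k=1}^3 p_ke_k$, $p_0,\dots,p_3\in\mathbb{C}$ (with $e_0=1$), with product $pq=p_0q_0+p_0\vec q+q_0\vec p-\vec p\cdot\vec q+\vec p\times\vec q$ (bilinear dot and cross products on $\mathbb{C}^3$, so $e_k^2=-1$ for $k=1,2,3$). Quaternionic conjugate: $\overline{p}=p_0-\vec p$. Inner product (conjugate-linear in the first slot): $\langle p,q\rangle_{\mathbb{H}_{\mathbb{C}}}=\sum_{k=0}^3p_k^*q_k$, $^*$ being complex conjugation. Domain: $G\subset\mathbb{R}^3$ is a bounded domain whose boundary $\Gamma$ is a Liapunov surface (in particular a $C^1$ surface with Hölder continuous unit normal), with $\mathbb{R}^3\setminus\overline{G}$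 connected. Function spaces: a function $u=\sum_{k=0}^3u_ke_k:G\to\mathbb{H}_{\mathbb{C}}$ belongs to $\mathscr{F}(G;\mathbb{H}_{\mathbb{C}})$ if each $u_k\in\mathscr{F}(G)$ (complex-valued space). $\langle u,v\rangle_{L_2(G;\mathbb{H}_{\mathbb{C}})}=\int_G\langle u(x),v(x)\rangle_{\mathbb{H}_{\mathbb{C}}}dV_x$. Operators: $\mathbf{D}=\sum_{k=1}^3e_k\frac{\partial}{\partial x_k}$ (acting from the left). A function $v\in L_{1,loc}(G;\mathbb{H}_{\mathbb{C}})$ is the weak $\mathbf{D}$-derivative of $u\in L_{1,loc}(G;\mathbb{H}_{\mathbb{C}})$, written $v=\mathbf{D}u$, if $\int_G\overline{u}(\mathbf{D}\varphi)=\int_G\overline{v}\varphi$ for all $\varphi\in C_0^\infty(G;\mathbb{H}_{\mathbb{C}})$. For $A=(a_1,a_2,a_3,a_4)\in(L_\infty(G;\mathbb{H}_{\mathbb{C}}))^4$, $\mathbf{Q}_Aw=wa_1+\overline{w}a_2+a_3w+a_4\overline{w}$. $\mathfrak{V}_A^2(G;\mathbb{H}_{\mathbb{C}})$ is the set of weak solutions $w\in L_2(G;\mathbb{H}_{\mathbb{C}})$ of $\mathbf{D}w-\mathbf{Q}_Aw=0$ in $G$, i.e. those $w\in L_2(G;\mathbb{H}_{\mathbb{C}})$ having a weak $\mathbf{D}$-derivative equal to $\mathbf{Q}_Aw$. It is a closed complex subspace of $L_2(G;\mathbb{H}_{\mathbb{C}})$, its elements have continuous representatives on $G$ (used for point values),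 and for each $x\in G$ the functionals $w\mapsto w_k(x)\in\mathbb{C}$, $k=0,1,2,3$, are bounded on it in the $L_2$-norm. Kernel: for $x\in G$ and $k\in\{0,1,2,3\}$, $K_x^k\in\mathfrak{V}_A^2(G;\mathbb{H}_{\mathbb{C}})$ is the unique element (Riesz representation) with $w_k(x)=\langle K_x^k,w\rangle_{L_2(G;\mathbb{H}_{\mathbb{C}})}$ for all $w\in\mathfrak{V}_A^2(G;\mathbb{H}_{\mathbb{C}})$. The Vekua-Bergman kernel with coefficient $a=\sum_{j=0}^3a_je_j\in\mathbb{H}_{\mathbb{C}}$ (here $a_j\in\mathbb{C}$) is $\mathscr{K}_G^A(x,t;a)=\sum_{j=0}^3K_t^j(x)a_j$, $x,t\in G$. *)

(* Defs.v *)
From HB Require Import structures.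
From mathcomp Require Import all_boot all_order all_algebra.
From mathcomp Require Import all_classical all_reals all_analysis.
From mathcomp Require Import complex.

Set Implicit Arguments.
Unset Strict Implicit.
Unset Printing Implicit Defensive.

Import Order.TTheory GRing.Theory Num.Theory.
Import numFieldNormedType.Exports.

Local Open Scope classical_set_scope.
Local Open Scope ring_scope.

(* The entry [p 0 k] is the coefficient of [e_k], with [e_0 = 1]. *)
Notation HC R := 'rV[R[i]]_4.

Definition hvec (R : realType) (p : HC R) : 'rV[R[i]]_3 :=
  \row_k p 0 (lift ord0 k).

Definition hmk (R : realType) (p0 : R[i]) (v : 'rV[R[i]]_3) : HC R :=
  row_mx (p0%:M : 'rV_1) v.

Definition cdot (R : realType) (u v : 'rV[R[i]]_3) : R[i] :=
  \sum_k u 0 k * v 0 k.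

(* Indices are added modulo 3. *)
Definition ccross (R : realType) (u v : 'rV[R[i]]_3) : 'rV[R[i]]_3 :=
  \row_(k < 3) (u 0 (k + 1) * v 0 (k + 2%:R) - u 0 (k + 2%:R) * v 0 (k + 1)).

Definition hmul (R : realType) (p q : HC R) : HC R :=
  hmk (p 0 0 * q 0 0 - cdot (hvec p) (hvec q))
      (p 0 0 *: hvec q + q 0 0 *: hvec p + ccross (hvec p) (hvec q)).

Definition hconj (R : realType) (p : HC R) : HC R := hmk (p 0 0) (- hvec p).

Definition hinner (R : realType) (p q : HC R) : R[i] :=
  \sum_k (p 0 k)^* * q 0 k.

(* [e_ j] is the imaginary unit written [e_(j+1)] when units are numbered
   from 1 to 3. *)
Definition e_ (R : realType) (j : 'I_3) : HC R := delta_mx 0 (lift ord0 j).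

Definition R3 (R : realType) : Type :=
  (measurableTypeR R * measurableTypeR R * measurableTypeR R)%type.

HB.instance Definition _ (R : realType) :=
  NormedModule.copy (R3 R) (R * R * R)%type.
HB.instance Definition _ (R : realType) :=
  Measurable.copy (R3 R)
    (measurableTypeR R * measurableTypeR R * measurableTypeR R)%type.

Definition leb3 (R : realType) : {measure set (R3 R) -> \bar R} :=
  ((@lebesgue_measure R \x @lebesgue_measure R) \x @lebesgue_measure R)%E.

Definition basis3 (R : realType) (j : 'I_3) : R3 R :=
  ((j == 0)%:R, (j == 1)%:R, (j == 2%:R)%:R).

(* The library's norm on a product is the sup norm. *)
Definition edot (R : realType) (x y : R3 R) : R :=
  x.1.1 * y.1.1 + x.1.2 * y.1.2 + x.2 * y.2.

Definition enorm (R : realType) (x : R3 R) : R := Num.sqrt (edot x x).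

Definition partial (R : realType) (j : 'I_3) (f : R3 R -> R) : R3 R -> R :=
  fun x => 'D_(basis3 R j) f x.

Definition gradient (R : realType) (f : R3 R -> R) (x : R3 R) : R3 R :=
  (partial 0 f x, partial 1 f x, partial 2%:R f x).

Definition C1_on (R : realType) (U : set (R3 R)) (f : R3 R -> R) : Prop :=
  forall j x, U x ->
    derivable f x (basis3 R j) /\ {for x, continuous (partial j f)}.

Definition iter_partial (R : realType) (s : seq 'I_3) (f : R3 R -> R) :=
  foldr (@partial R) f s.

Definition smooth (R : realType) (f : R3 R -> R) : Prop :=
  forall s, continuous (iter_partial s f) /\
    forall j x, derivable (iter_partial s f) x (basis3 R j).

Definition boundary (R : realType) (G : set (R3 R)) : set (R3 R) :=
  closure G `\` interior G.

(* [nu] is a unit normal field of the surface [S], which near each of its points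
   is a regular level set of a C^1 function. *)
Definition C1_surface_with_normal (R : realType) (S : set (R3 R))
    (nu : R3 R -> R3 R) : Prop :=
  (forall x, S x -> enorm (nu x) = 1) /\
  forall p, S p -> exists (U : set (R3 R)) (f : R3 R -> R),
    [/\ open U, U p, C1_on U f,
        forall x, U x -> (S x <-> f x = 0) &
        forall x, U x -> S x -> exists2 c : R, c != 0 & gradient f x = c *: nu x].

(* Liapunov's conditions: tangent planes exist, the normal is Hoelder continuous,
   and inside balls of some uniform radius, a line parallel to the normal at the
   centre meets the surface at most once. *)
Definition Liapunov_surface (R : realType) (S : set (R3 R)) : Prop :=
  exists nu : R3 R -> R3 R,
    [/\ C1_surface_with_normal S nu,
        exists L lambda : R, 0 < lambda <= 1 /\
          forall x y, S x -> S y ->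
            enorm (nu x - nu y) <= L * enorm (x - y) `^ lambda &
        exists2 d : R, 0 < d & forall x y (s : R),
          S x -> S y -> S (y + s *: nu x) ->
          enorm (y - x) < d -> enorm (y + s *: nu x - x) < d -> s = 0].

Definition Liapunov_domain (R : realType) (G : set (R3 R)) : Prop :=
  [/\ open G, connected G, G !=set0 & bounded_set G] /\
  Liapunov_surface (boundary G) /\ connected (~` closure G).

Definition re_part (R : realType) (u : R3 R -> HC R) (k : 'I_4) : R3 R -> R :=
  fun x => complex.Re (u x 0 k).

Definition im_part (R : realType) (u : R3 R -> HC R) (k : 'I_4) : R3 R -> R :=
  fun x => complex.Im (u x 0 k).

Definition cintegral (R : realType) (G : set (R3 R)) (f : R3 R -> R[i]) : R[i] :=
  Complex (\int[@leb3 R]_(x in G) complex.Re (f x))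
          (\int[@leb3 R]_(x in G) complex.Im (f x)).

Definition hintegral (R : realType) (G : set (R3 R)) (u : R3 R -> HC R) : HC R :=
  \row_k cintegral G (fun x => u x 0 k).

Definition hintegrable (R : realType) (G : set (R3 R)) (u : R3 R -> HC R) : Prop :=
  forall k, (@leb3 R).-integrable G (EFin \o re_part u k) /\
            (@leb3 R).-integrable G (EFin \o im_part u k).

Definition hmeasurable (R : realType) (G : set (R3 R)) (u : R3 R -> HC R) : Prop :=
  forall k, measurable_fun G (re_part u k) /\ measurable_fun G (im_part u k).

Definition hcontinuous (R : realType) (G : set (R3 R)) (u : R3 R -> HC R) : Prop :=
  forall k x, G x ->
    {for x, continuous (re_part u k)} /\ {for x, continuous (im_part u k)}.

(* Elements of Lebesgue spaces are represented by Borel functions that are not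
   identified when they agree almost everywhere. *)
Definition L1loc (R : realType) (G : set (R3 R)) (u : R3 R -> HC R) : Prop :=
  hmeasurable G u /\
  forall K : set (R3 R), compact K -> K `<=` G -> hintegrable K u.

Definition L2 (R : realType) (G : set (R3 R)) (u : R3 R -> HC R) : Prop :=
  hmeasurable G u /\
  forall k, (\int[@leb3 R]_(x in G) (Normc.normc (u x 0 k) ^+ 2)%:E < +oo)%E.

Definition Linfty (R : realType) (G : set (R3 R)) (u : R3 R -> HC R) : Prop :=
  hmeasurable G u /\
  forall k, exists M : R,
    {ae @leb3 R, forall x, G x -> Normc.normc (u x 0 k) <= M}.

Definition L2_inner (R : realType) (G : set (R3 R)) (u v : R3 R -> HC R) : R[i] :=
  cintegral G (fun x => hinner (u x) (v x)).

Definition test_function (R : realType) (G : set (R3 R)) (phi : R3 R -> HC R) : Prop :=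
  [/\ forall k, smooth (re_part phi k) /\ smooth (im_part phi k),
      compact (closure [set x | phi x != 0]) &
      closure [set x | phi x != 0] `<=` G].

Definition hpartial (R : realType) (j : 'I_3) (phi : R3 R -> HC R) (x : R3 R) : HC R :=
  \row_k Complex (partial j (re_part phi k) x) (partial j (im_part phi k) x).

Definition Dop (R : realType) (phi : R3 R -> HC R) (x : R3 R) : HC R :=
  \sum_(j < 3) hmul (e_ R j) (hpartial j phi x).

Definition weak_D (R : realType) (G : set (R3 R)) (u v : R3 R -> HC R) : Prop :=
  [/\ L1loc G u, L1loc G v &
      forall phi, test_function G phi ->
        hintegral G (fun x => hmul (hconj (u x)) (Dop phi x)) =
        hintegral G (fun x => hmul (hconj (v x)) (phi x))].

(* [A 0], ..., [A 3] are the coefficients a_1, ..., a_4. *)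
Definition Qop (R : realType) (A : 'I_4 -> R3 R -> HC R) (w : R3 R -> HC R)
    (x : R3 R) : HC R :=
  hmul (w x) (A 0 x) + hmul (hconj (w x)) (A 1 x) +
  hmul (A 2%:R x) (w x) + hmul (A 3%:R x) (hconj (w x)).

Definition Vekua_space (R : realType) (G : set (R3 R)) (A : 'I_4 -> R3 R -> HC R)
    (w : R3 R -> HC R) : Prop :=
  L2 G w /\ weak_D G w (Qop A w).

(* The value at a point of an almost-everywhere class [w] is the value there of
   its continuous representative [W]. *)
Definition continuous_rep (R : realType) (G : set (R3 R)) (w W : R3 R -> HC R) : Prop :=
  hcontinuous G W /\ {ae @leb3 R, forall x, G x -> w x = W x}.

(* [K k x] is the Riesz representative K_x^k of the functional w |-> w_k(x),
   taken in its continuous version; this determines [K k x] on [G]. *)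
Definition Riesz_kernels (R : realType) (G : set (R3 R)) (A : 'I_4 -> R3 R -> HC R)
    (K : 'I_4 -> R3 R -> R3 R -> HC R) : Prop :=
  forall k x, G x ->
    [/\ Vekua_space G A (K k x), hcontinuous G (K k x) &
        forall w W, Vekua_space G A w -> continuous_rep G w W ->
          W x 0 k = L2_inner G (K k x) w].

Definition Vekua_Bergman_kernel (R : realType) (K : 'I_4 -> R3 R -> R3 R -> HC R)
    (x t : R3 R) (a : HC R) : HC R :=
  \sum_j a 0 j *: K j t x.

(* Main.v *)
(* The Vekua-Bergman kernel is Hermitian: applying the defining property of
   K_x^k to K_t^j and conversely gives (K_t^j(x))_k = ((K_x^k(t))_j)^*.  Hence
   the k-th component of the integrand in (ii) is <K_x^k(t), W(t)>, whose integral
   over G is w_k(x).  Part (i) says that the Vekua space is stable under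
   complex linear combinations: Q_A is complex linear, and against a test
   function phi the products with phi and D phi are integrable because these are
   continuous with compact support in G. *)

Require Import Defs.
From mathcomp Require Import all_boot all_order all_algebra.
From mathcomp Require Import all_classical all_reals all_analysis.
From mathcomp Require Import measurable_realfun complex ring lra.

Set Implicit Arguments.
Unset Strict Implicit.
Unset Printing Implicit Defensive.

Import Order.TTheory GRing.Theory Num.Theory.
Import numFieldNormedType.Exports.

Local Open Scope classical_set_scope.
Local Open Scope ring_scope.

(** * Borel measurability of open, closed and compact subsets of R^3 *)

Definition ratbox (R : realType) (q : (rat * rat) * (rat * rat) * (rat * rat)) :
    set (R3 R) :=
  [set` `](ratr q.1.1.1 : R), ratr q.1.1.2[] `*` [set` `](ratr q.1.2.1 : R), ratr q.1.2.2[]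
    `*` [set` `](ratr q.2.1 : R), ratr q.2.2[].

Lemma measurable_ratbox (R : realType) q : measurable (@ratbox R q).
Proof. by apply: measurableX; first apply: measurableX; exact: measurable_itv. Qed.

Lemma rat_itv_ball (R : realType) (a e : R) : 0 < e ->
  exists q : rat * rat, (a \in `](ratr q.1 : R), ratr q.2[) /\
    [set` `](ratr q.1 : R), ratr q.2[] `<=` ball a e.
Proof.
move=> e0.
have [p] : exists q : rat, ratr q \in `]a - e, a[.
  by apply: rat_in_itvoo; rewrite ltrBlDr ltrDl.
have [q] : exists q : rat, ratr q \in `]a, a + e[.
  by apply: rat_in_itvoo; rewrite ltrDl.
rewrite !in_itv/= => /andP[aq qe] /andP[ep pa]; exists (p, q); split => /=.
  by rewrite in_itv/= pa aq.
move=> x /=; rewrite in_itv/= => /andP[px xq]; rewrite /ball/= ltr_distlC.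
by rewrite (lt_trans ep px) (lt_trans xq qe).
Qed.

(** The topology and the sigma-algebra of [R3] come from separate product structures. They are
    linked by the countable base of rational boxes: an open set is the union of the boxes that it
    contains, and each box is measurable. *)
Lemma open_R3_measurable (R : realType) (U : set (R3 R)) : open U -> measurable U.
Proof.
move=> oU.
(* Boxes that leave [U] are replaced by the empty set, so that the union runs over a whole countable
   type. *)
pose F q := if `[< @ratbox R q `<=` U >] then @ratbox R q else set0.
have -> : U = \bigcup_q F q.
  apply/seteqP; split=> [x Ux|x [q _]]; last first.
    by rewrite /F; case: ifPn => // /asboolP; exact.
  have /nbhs_ballP[e /= e0 xeU] : nbhs x U by exact: open_nbhs_nbhs.
  have [q1 [xq1 q1e]] := rat_itv_ball x.1.1 e0.
  have [q2 [xq2 q2e]] := rat_itv_ball x.1.2 e0.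
  have [q3 [xq3 q3e]] := rat_itv_ball x.2 e0.
  exists (q1, q2, q3) => //; rewrite /F asboolT; last first.
    move=> y [[y1 y2] y3]; apply: xeU; split; first split.
    - exact: q1e.
    - exact: q2e.
    - exact: q3e.
  by split; first split.
apply: countable_bigcupT_measurable => [|q]; first exact: countableP.
by rewrite /F; case: ifPn => // _; exact: measurable_ratbox.
Qed.

Lemma closed_R3_measurable (R : realType) (F : set (R3 R)) : closed F -> measurable F.
Proof.
by move=> cF; rewrite -[F]setCK; apply: measurableC; apply: open_R3_measurable;
  exact: closed_openC.
Qed.

Lemma compact_R3_measurable (R : realType) (K : set (R3 R)) : compact K -> measurable K.
Proof.
by move=> cK; apply: closed_R3_measurable; apply: compact_closed cK; exact: norm_hausdorff.
Qed.

(** Open intervals generate the Borel sets of the line, and the part of [G] that [f] sends into such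
    an interval is open. *)
Lemma continuous_on_open_measurable (R : realType) (G : set (R3 R)) (f : R3 R -> R) :
  open G -> (forall x, G x -> {for x, continuous f}) -> measurable_fun G f.
Proof.
move=> oG cf; apply: (measurability _ (RGenOpens.measurableE R)).
move=> _ [_ [a [b ->]] <-]; apply: open_R3_measurable.
rewrite openE => x [Gx fx]; apply: filterI.
  exact: open_nbhs_nbhs.
apply: (cf _ Gx); apply: open_nbhs_nbhs; split => //; exact: interval_open.
Qed.

(** * Measurability and integration of complex-valued functions *)

Lemma ReD (R : realType) (a b : R[i]) : complex.Re (a + b) = complex.Re a + complex.Re b.
Proof. by case: a b => [? ?] [? ?]. Qed.

Lemma ImD (R : realType) (a b : R[i]) : complex.Im (a + b) = complex.Im a + complex.Im b.
Proof. by case: a b => [? ?] [? ?]. Qed.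

Lemma ReM (R : realType) (a b : R[i]) :
  complex.Re (a * b) = complex.Re a * complex.Re b - complex.Im a * complex.Im b.
Proof. by case: a b => [? ?] [? ?]. Qed.

Lemma ImM (R : realType) (a b : R[i]) :
  complex.Im (a * b) = complex.Re a * complex.Im b + complex.Im a * complex.Re b.
Proof. by case: a b => [? ?] [? ?]. Qed.

Lemma Re_conj (R : realType) (a : R[i]) : complex.Re (Num.conj a) = complex.Re a.
Proof. by case: a. Qed.

Lemma Im_conj (R : realType) (a : R[i]) : complex.Im (Num.conj a) = - complex.Im a.
Proof. by case: a. Qed.

Lemma complex_ext (R : realType) (a b : R[i]) :
  complex.Re a = complex.Re b -> complex.Im a = complex.Im b -> a = b.
Proof. by case: a b => [? ?] [? ?] /= -> ->. Qed.

(** This predicate and [cintegrable] are, up to conversion, what [hmeasurable] and [hintegrable]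
    assert of a single coordinate; later proofs pass between the two forms without rewriting. *)
Definition cmeasurable (R : realType) (D : set (R3 R)) (f : R3 R -> R[i]) : Prop :=
  measurable_fun D (fun x => complex.Re (f x)) /\
  measurable_fun D (fun x => complex.Im (f x)).

Definition cintegrable (R : realType) (D : set (R3 R)) (f : R3 R -> R[i]) : Prop :=
  (@leb3 R).-integrable D (EFin \o (fun x => complex.Re (f x))) /\
  (@leb3 R).-integrable D (EFin \o (fun x => complex.Im (f x))).

Section complex_valued.
Context (R : realType) (D : set (R3 R)).
Implicit Types f g : R3 R -> R[i].

Lemma cmeasurableD f g :
  cmeasurable D f -> cmeasurable D g -> cmeasurable D (fun x => f x + g x).
Proof.
move=> [f1 f2] [g1 g2]; split.
- by under eq_fun do rewrite ReD; exact: measurable_funD.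
- by under eq_fun do rewrite ImD; exact: measurable_funD.
Qed.

Lemma cmeasurableM f g :
  cmeasurable D f -> cmeasurable D g -> cmeasurable D (fun x => f x * g x).
Proof.
move=> [f1 f2] [g1 g2]; split.
- by under eq_fun do rewrite ReM; apply: measurable_funB; exact: measurable_funM.
- by under eq_fun do rewrite ImM; apply: measurable_funD; exact: measurable_funM.
Qed.

Lemma cmeasurable_cst (c : R[i]) : cmeasurable D (fun=> c).
Proof. by split; exact: measurable_cst. Qed.

Lemma cmeasurableZ (c : R[i]) f : cmeasurable D f -> cmeasurable D (fun x => c * f x).
Proof. by apply: cmeasurableM; exact: cmeasurable_cst. Qed.

Lemma cmeasurable_conj f : cmeasurable D f -> cmeasurable D (fun x => Num.conj (f x)).
Proof.
move=> [f1 f2]; split.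
- by under eq_fun do rewrite Re_conj.
- by under eq_fun do rewrite Im_conj; exact: measurable_funN.
Qed.

Hypothesis mD : measurable D.

Lemma cintegrable_ext f g :
  (forall x, D x -> f x = g x) -> cintegrable D f -> cintegrable D g.
Proof.
move=> fg [f1 f2]; split.
- by apply: eq_integrable f1 => // x /set_mem Dx /=; rewrite fg.
- by apply: eq_integrable f2 => // x /set_mem Dx /=; rewrite fg.
Qed.

Lemma cintegrableD f g :
  cintegrable D f -> cintegrable D g -> cintegrable D (fun x => f x + g x).
Proof.
move=> [f1 f2] [g1 g2]; split.
- by apply: eq_integrable (integrableD mD f1 g1) => // x _ /=; rewrite ReD EFinD.
- by apply: eq_integrable (integrableD mD f2 g2) => // x _ /=; rewrite ImD EFinD.
Qed.

Lemma cintegrableZ (c : R[i]) f : cintegrable D f -> cintegrable D (fun x => c * f x).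
Proof.
move=> [f1 f2]; split.
- apply: eq_integrable (integrableB mD (integrableZl mD (complex.Re c) f1)
    (integrableZl mD (complex.Im c) f2)) => // x _ /=.
  by rewrite ReM EFinB.
- apply: eq_integrable (integrableD mD (integrableZl mD (complex.Re c) f2)
    (integrableZl mD (complex.Im c) f1)) => // x _ /=.
  by rewrite ImM EFinD.
Qed.

Lemma cintegrable0 : cintegrable D (fun=> 0).
Proof. by split; exact: integrable0. Qed.

Lemma cintegrable_sum (I : Type) (s : seq I) (P : pred I) (h : I -> R3 R -> R[i]) :
  (forall i, P i -> cintegrable D (h i)) ->
  cintegrable D (fun x => \sum_(i <- s | P i) h i x).
Proof.
move=> hi; elim: s => [|i s IH].
  by apply: cintegrable_ext cintegrable0 => x _; rewrite big_nil.
have [Pi|Pi] := boolP (P i).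
  by apply: cintegrable_ext (cintegrableD (hi i Pi) IH) => x _; rewrite big_cons Pi.
by apply: cintegrable_ext IH => x _; rewrite big_cons (negPf Pi).
Qed.

Lemma eq_cintegral f g : (forall x, D x -> f x = g x) -> cintegral D f = cintegral D g.
Proof.
by move=> fg; congr Complex; apply: eq_Rintegral => x /set_mem /fg ->.
Qed.

Lemma cintegralD f g : cintegrable D f -> cintegrable D g ->
  cintegral D (fun x => f x + g x) = cintegral D f + cintegral D g.
Proof.
move=> [f1 f2] [g1 g2]; apply: complex_ext; rewrite ?ReD ?ImD /=.
- by under eq_Rintegral do rewrite ReD; exact: RintegralD.
- by under eq_Rintegral do rewrite ImD; exact: RintegralD.
Qed.

Lemma cintegralZ (c : R[i]) f : cintegrable D f ->
  cintegral D (fun x => c * f x) = c * cintegral D f.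
Proof.
move=> [f1 f2].
have Z (a : R) (g : R3 R -> R) : (@leb3 R).-integrable D (EFin \o g) ->
    (@leb3 R).-integrable D (EFin \o (fun x => a * g x)).
  by move=> gi; apply: eq_integrable (integrableZl mD a gi).
apply: complex_ext; rewrite ?ReM ?ImM /=.
- under eq_Rintegral do rewrite ReM.
  by rewrite RintegralB ?RintegralZl//; exact: Z.
- under eq_Rintegral do rewrite ImM.
  by rewrite RintegralD ?RintegralZl//; exact: Z.
Qed.

Lemma cintegral_conj f : cintegrable D f ->
  cintegral D (fun x => Num.conj (f x)) = Num.conj (cintegral D f).
Proof.
move=> [f1 f2]; apply: complex_ext; rewrite ?Re_conj ?Im_conj /=.
- by under eq_Rintegral do rewrite Re_conj.
- under eq_Rintegral do rewrite Im_conj -mulN1r.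
  by rewrite RintegralZl// mulN1r.
Qed.

Lemma ae_eq_cintegral f g : cmeasurable D f -> cmeasurable D g ->
  {ae @leb3 R, forall x, D x -> f x = g x} -> cintegral D f = cintegral D g.
Proof.
move=> [f1 f2] [g1 g2] fg; congr Complex; congr fine; apply: ae_eq_integral => //;
  try exact/measurable_EFinP; apply: filterS fg => x + Dx => /(_ Dx) -> //.
Qed.

End complex_valued.

(** * Complex bilinearity of the biquaternion product *)

Section hmul_linear.
Context (R : realType).
Implicit Types (p q : HC R) (c : R[i]).

Lemma hmk0 a (v : 'rV[R[i]]_3) : hmk a v 0 0 = a.
Proof.
(* [hmk] glues blocks of widths 1 and 3, so an index has to be exhibited as coming from one of the
   blocks before an entry can be read. *)
have -> : (0 : 'I_4) = lshift 3 (ord0 : 'I_1) by apply/val_inj.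
by rewrite /hmk (@row_mxEl _ 1 1 3) mxE eqxx mulr1n.
Qed.

Lemma hmk_lift a (v : 'rV[R[i]]_3) k : hmk a v 0 (lift ord0 k) = v 0 k.
Proof.
have -> : lift ord0 k = rshift 1 k by apply/val_inj.
by rewrite /hmk (@row_mxEr _ 1 1 3).
Qed.

(** The shape [c * a + b] carries additivity and homogeneity at once. The linearity lemmas below
    keep it so that they compose by rewriting. *)
Lemma hmk_linear c a b (u v : 'rV[R[i]]_3) :
  hmk (c * a + b) (c *: u + v) = c *: hmk a u + hmk b v.
Proof.
apply/rowP => i; rewrite [RHS]mxE [X in _ = X + _]mxE.
case: (unliftP ord0 i) => [k ->|->]; last by rewrite !hmk0.
by rewrite !hmk_lift !mxE.
Qed.

Lemma hvec_linear c p q : hvec (c *: p + q) = c *: hvec p + hvec q.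
Proof. by apply/rowP => k; rewrite !mxE. Qed.

Lemma hconj_linear c p q : hconj (c *: p + q) = c *: hconj p + hconj q.
Proof. by rewrite /hconj -hmk_linear hvec_linear opprD -scalerN !mxE. Qed.

Lemma hmul_linearl q c p p' : hmul (c *: p + p') q = c *: hmul p q + hmul p' q.
Proof.
rewrite /hmul -hmk_linear hvec_linear !mxE; congr hmk.
  (* The scalar part still contains the finite sum [cdot]: the products of scalar parts are
     cancelled first, and the sums are then compared term by term. *)
  rewrite mulrDl mulrBr mulrA -!addrA; congr (_ + _); rewrite [RHS]addrCA; congr (_ + _).
  rewrite -opprD mulr_sumr -big_split /=; congr (- _); apply: eq_bigr => k _.
  by rewrite !mxE; ring.
by apply/rowP => k; rewrite !mxE; ring.
Qed.

Lemma hmul_linearr p c q q' : hmul p (c *: q + q') = c *: hmul p q + hmul p q'.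
Proof.
rewrite /hmul -hmk_linear hvec_linear !mxE; congr hmk.
  rewrite mulrDr mulrBr -!addrA mulrCA; congr (_ + _); rewrite [RHS]addrCA; congr (_ + _).
  rewrite -opprD mulr_sumr -big_split /=; congr (- _); apply: eq_bigr => k _.
  by rewrite !mxE; ring.
by apply/rowP => k; rewrite !mxE; ring.
Qed.

Lemma hmul0l q : hmul 0 q = 0.
(* With coefficient -1 and both arguments 0, linearity reads [hmul 0 q = - hmul 0 q + hmul 0 q]. *)
Proof. by have := hmul_linearl q (-1) 0 0; rewrite scaler0 addr0 scaleN1r addNr. Qed.

Lemma hmul0r p : hmul p 0 = 0.
Proof. by have := hmul_linearr p (-1) 0 0; rewrite scaler0 addr0 scaleN1r addNr. Qed.

Lemma hmul_suml (I : Type) (s : seq I) (a : I -> R[i]) (p : I -> HC R) q :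
  hmul (\sum_(i <- s) a i *: p i) q = \sum_(i <- s) a i *: hmul (p i) q.
Proof.
by elim: s => [|i s IH]; rewrite ?big_nil ?hmul0l// !big_cons hmul_linearl IH.
Qed.

Lemma hmul_sumr (I : Type) (s : seq I) (a : I -> R[i]) p (q : I -> HC R) :
  hmul p (\sum_(i <- s) a i *: q i) = \sum_(i <- s) a i *: hmul p (q i).
Proof.
by elim: s => [|i s IH]; rewrite ?big_nil ?hmul0r// !big_cons hmul_linearr IH.
Qed.

(** Bilinearity makes each coordinate a combination, with constant coefficients, of products of
    complex coordinates. Integrability and continuity of [hmul] thus reduce to the scalar case, and
    the structure constants need not be computed. *)
Lemma hmul_coordE p q k : hmul p q 0 k =
  \sum_i \sum_j hmul (delta_mx 0 i) (delta_mx 0 j) 0 k * (p 0 i * q 0 j).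
Proof.
rewrite {1}(row_sum_delta p) hmul_suml summxE; apply: eq_bigr => i _.
rewrite {1}(row_sum_delta q) hmul_sumr mxE summxE mulr_sumr; apply: eq_bigr => j _.
by rewrite mxE; ring.
Qed.

Lemma hconj_coordE p k : hconj p 0 k = (if k == 0 then 1 else -1) * p 0 k.
Proof.
rewrite /hconj; case: (unliftP ord0 k) => [j ->|->]; last by rewrite hmk0 mul1r.
by rewrite hmk_lift !mxE mulN1r.
Qed.

End hmul_linear.

(** * Square-integrable functions *)

Definition sqintegrable (R : realType) (D : set (R3 R)) (f : R3 R -> R) : Prop :=
  measurable_fun D f /\ (@leb3 R).-integrable D (EFin \o (fun x => f x ^+ 2)).

Section square_integrable.
Context (R : realType) (D : set (R3 R)).
Hypothesis mD : measurable D.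
Implicit Types f g : R3 R -> R.

(** The product is dominated by [f ^+ 2 + g ^+ 2], since the square of [|f| - |g|] is
    nonnegative. *)
Lemma sqintegrableM f g : sqintegrable D f -> sqintegrable D g ->
  (@leb3 R).-integrable D (EFin \o (fun x => f x * g x)).
Proof.
move=> [mf f2] [mg g2].
apply: (le_integrable mD _ _ (integrableD mD f2 g2)).
  by apply/measurable_EFinP; exact: measurable_funM.
move=> x _; rewrite /= lee_fin normrM.
rewrite [leRHS]ger0_norm ?addr_ge0 ?sqr_ge0//.
rewrite -[X in _ <= X + _]real_normK ?num_real// -[X in _ <= _ + X]real_normK ?num_real//.
have := sqr_ge0 (`|f x| - `|g x|); have := sqr_ge0 (`|f x|); have := sqr_ge0 (`|g x|).
nra.
Qed.

Lemma sqintegrableD f g : sqintegrable D f -> sqintegrable D g ->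
  sqintegrable D (fun x => f x + g x).
Proof.
move=> fL gL; have fg := sqintegrableM fL gL; case: fL gL => [mf f2] [mg g2]; split.
  exact: measurable_funD.
(* The square of the sum is split as [(f^2 + f g) + (f g + g^2)], whose terms are all integrable. *)
apply: eq_integrable (integrableD mD (integrableD mD f2 fg)
  (integrableD mD fg g2)) => // x _ /=.
by congr EFin; ring.
Qed.

Lemma sqintegrableZ (c : R) f : sqintegrable D f -> sqintegrable D (fun x => c * f x).
Proof.
move=> [mf f2]; split; first exact: measurable_funM.
by apply: eq_integrable (integrableZl mD (c ^+ 2) f2) => // x _ /=; rewrite -EFinM exprMn.
Qed.

End square_integrable.

Definition csqintegrable (R : realType) (D : set (R3 R)) (f : R3 R -> R[i]) : Prop :=
  sqintegrable D (fun x => complex.Re (f x)) /\ sqintegrable D (fun x => complex.Im (f x)).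

Section complex_square_integrable.
Context (R : realType) (D : set (R3 R)).
Hypothesis mD : measurable D.
Implicit Types f g : R3 R -> R[i].

Lemma sqr_normc (z : R[i]) :
  Normc.normc z ^+ 2 = complex.Re z ^+ 2 + complex.Im z ^+ 2.
Proof. by case: z => a b /=; rewrite sqr_sqrtr// addr_ge0 ?sqr_ge0. Qed.

(** The squared modulus is the sum of the squares of the real and imaginary parts, so it dominates
    each of them. *)
Lemma csqintegrableP f : csqintegrable D f <->
  cmeasurable D f /\ (\int[@leb3 R]_(x in D) (Normc.normc (f x) ^+ 2)%:E < +oo)%E.
Proof.
split=> [[[m1 i1] [m2 i2]]|[[m1 m2] fi]].
  split; first by split.
  have /integrableP[_] := integrableD mD i1 i2; apply: le_lt_trans.
  rewrite le_eqVlt; apply/orP; left; apply/eqP; apply: eq_integral => x _ /=.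
  by rewrite sqr_normc ger0_norm ?addr_ge0 ?sqr_ge0.
have : (@leb3 R).-integrable D (EFin \o (fun x => Normc.normc (f x) ^+ 2)).
  apply/integrableP; split.
    apply/measurable_EFinP; under eq_fun do rewrite sqr_normc.
    by apply: measurable_funD; exact: measurable_funX.
  by apply: le_lt_trans fi; rewrite le_eqVlt; apply/orP; left; apply/eqP;
    apply: eq_integral => x _ /=; rewrite ger0_norm// sqr_ge0.
move=> ni; split; split => //; apply: (le_integrable mD _ _ ni).
- by apply/measurable_EFinP; exact: measurable_funX.
- move=> x _ /=; rewrite lee_fin !ger0_norm ?sqr_ge0// sqr_normc.
  by rewrite lerDl sqr_ge0.
- by apply/measurable_EFinP; exact: measurable_funX.
- move=> x _ /=; rewrite lee_fin !ger0_norm ?sqr_ge0// sqr_normc.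
  by rewrite lerDr sqr_ge0.
Qed.

Lemma csqintegrableM f g : csqintegrable D f -> csqintegrable D g ->
  cintegrable D (fun x => f x * g x).
Proof.
move=> [f1 f2] [g1 g2]; split.
- apply: eq_integrable (integrableB mD (sqintegrableM mD f1 g1)
    (sqintegrableM mD f2 g2)) => // x _ /=.
  by rewrite ReM.
- apply: eq_integrable (integrableD mD (sqintegrableM mD f1 g2)
    (sqintegrableM mD f2 g1)) => // x _ /=.
  by rewrite ImM.
Qed.

Lemma csqintegrableD f g : csqintegrable D f -> csqintegrable D g ->
  csqintegrable D (fun x => f x + g x).
Proof.
move=> [f1 f2] [g1 g2]; split.
- by under eq_fun do rewrite ReD; exact: sqintegrableD.
- by under eq_fun do rewrite ImD; exact: sqintegrableD.
Qed.

Lemma csqintegrableZ (c : R[i]) f : csqintegrable D f ->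
  csqintegrable D (fun x => c * f x).
Proof.
move=> [f1 f2]; split.
- under eq_fun do rewrite ReM -mulNr.
  by apply: sqintegrableD => //; exact: sqintegrableZ.
- under eq_fun do rewrite ImM.
  by apply: sqintegrableD => //; exact: sqintegrableZ.
Qed.

Lemma csqintegrable_conj f : csqintegrable D f ->
  csqintegrable D (fun x => Num.conj (f x)).
Proof.
move=> [f1 f2]; split.
- by under eq_fun do rewrite Re_conj.
- under eq_fun do rewrite Im_conj -mulN1r.
  exact: sqintegrableZ.
Qed.

End complex_square_integrable.

(** * Products of locally integrable functions with continuous functions of compact support *)

Definition continuous_supported (R : realType) (S : set (R3 R)) (g : R3 R -> R) : Prop :=
  continuous g /\ forall x, ~ S x -> g x = 0.

Definition ccontinuous_supported (R : realType) (S : set (R3 R)) (g : R3 R -> R[i]) :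
    Prop :=
  continuous_supported S (fun x => complex.Re (g x)) /\
  continuous_supported S (fun x => complex.Im (g x)).

Section local_multipliers.
Context (R : realType) (S G : set (R3 R)).

Lemma ccontinuous_supportedZ (c : R[i]) g : ccontinuous_supported S g ->
  ccontinuous_supported S (fun x => c * g x).
Proof.
move=> [[c1 z1] [c2 z2]]; split; split.
- under eq_fun do rewrite ReM; move=> x.
  by apply: cvgB; apply: cvgM; [exact: cvg_cst|exact: c1|exact: cvg_cst|exact: c2].
- by move=> x Sx; rewrite ReM z1// z2// !mulr0 subr0.
- under eq_fun do rewrite ImM; move=> x.
  by apply: cvgD; apply: cvgM; [exact: cvg_cst|exact: c2|exact: cvg_cst|exact: c1].
- by move=> x Sx; rewrite ImM z1// z2// !mulr0 addr0.
Qed.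

Lemma ccontinuous_supportedD f g : ccontinuous_supported S f ->
  ccontinuous_supported S g -> ccontinuous_supported S (fun x => f x + g x).
Proof.
move=> [[c1 z1] [c2 z2]] [[d1 y1] [d2 y2]]; split; split.
- by under eq_fun do rewrite ReD; move=> x; apply: cvgD; [exact: c1|exact: d1].
- by move=> x Sx; rewrite ReD z1// y1// addr0.
- by under eq_fun do rewrite ImD; move=> x; apply: cvgD; [exact: c2|exact: d2].
- by move=> x Sx; rewrite ImD z2// y2// addr0.
Qed.

Lemma ccontinuous_supported_sum (I : Type) (s : seq I) (h : I -> R3 R -> R[i]) :
  (forall i, ccontinuous_supported S (h i)) ->
  ccontinuous_supported S (fun x => \sum_(i <- s) h i x).
Proof.
move=> hi; elim: s => [|i s IH].
  by under eq_fun do rewrite big_nil; split; split => // x; exact: cvg_cst.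
by under eq_fun do rewrite big_cons; exact: ccontinuous_supportedD.
Qed.

Hypotheses (cS : compact S) (SG : S `<=` G) (mG : measurable G).

(** On the compact set [S] the function [g] is bounded and measurable, so [u * g] is integrable
    there; off [S] the product vanishes. *)
Lemma integrableM_supported (u g : R3 R -> R) :
  (@leb3 R).-integrable S (EFin \o u) -> continuous_supported S g ->
  (@leb3 R).-integrable G (EFin \o (fun x => u x * g x)).
Proof.
move=> ui [cg g0]; have mS := compact_R3_measurable cS.
have bg : [bounded g x | x in S].
  have cgS : compact (g @` S : set R^o).
    by apply: continuous_compact => //; exact: continuous_subspaceT.
  have := compact_bounded cgS.
  by rewrite /bounded_set /bounded_near; apply: filterS => M gM x Sx; apply: gM; exists x.
have mg : measurable_fun S g.
  apply: (@measurable_funS _ _ _ _ setT) => //.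
  by apply: continuous_on_open_measurable => [|x _]; [exact: openT|exact: cg].
(* Both integrability claims are moved to extensions by zero. Those of [u * g] from [G] and from [S]
   agree everywhere, because [S] lies in [G] and [g] is zero off [S]. *)
apply/(integrable_mkcond _ mG).
have /(integrable_mkcond _ mS) := integrableMl mS ui mg bg.
apply: eq_integrable => // x _; rewrite !patchE /=.
case: ifPn => [/set_mem/SG xG|/negP xS]; first by rewrite mem_set.
case: ifPn => // _; rewrite g0 ?mulr0// => Sx; apply: xS; exact: mem_set.
Qed.

Lemma cintegrableM_supported (u g : R3 R -> R[i]) :
  cintegrable S u -> ccontinuous_supported S g -> cintegrable G (fun x => u x * g x).
Proof.
move=> [u1 u2] [g1 g2]; split.
- apply: eq_integrable (integrableB mG (integrableM_supported u1 g1)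
    (integrableM_supported u2 g2)) => // x _ /=.
  by rewrite ReM.
- apply: eq_integrable (integrableD mG (integrableM_supported u1 g2)
    (integrableM_supported u2 g1)) => // x _ /=.
  by rewrite ImM.
Qed.

Lemma cintegrable_hmul (u psi : R3 R -> HC R) k :
  hintegrable S u -> (forall j, ccontinuous_supported S (fun x => psi x 0 j)) ->
  cintegrable G (fun x => hmul (u x) (psi x) 0 k).
Proof.
move=> ui hpsi.
apply: (@cintegrable_ext _ _ mG (fun x => \sum_i \sum_j
    hmul (delta_mx 0 i) (delta_mx 0 j) 0 k * (u x 0 i * psi x 0 j))).
  by move=> x _; rewrite [RHS]hmul_coordE.
apply: cintegrable_sum => // i _; apply: cintegrable_sum => // j _.
apply: cintegrableZ => //; apply: cintegrableM_supported => //; exact: ui.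
Qed.

End local_multipliers.

(** * Supports of test functions and of their derivatives *)

Section test_functions.
Context (R : realType) (G : set (R3 R)) (phi : R3 R -> HC R).
Hypothesis Gphi : test_function G phi.
Let S := closure [set x | phi x != 0].

(** The complement of the closed support is open. Vanishing on a whole neighbourhood, and not only
    at [x], is what forces the partial derivatives at [x] to vanish. *)
Lemma near_test_function0 x : ~ S x -> \forall y \near x, phi y = 0.
Proof.
move=> Sx; have : nbhs x (~` S).
  by apply: open_nbhs_nbhs; split => //; apply: closed_openC; exact: closed_closure.
apply: filterS => y Sy; apply/eqP/negPn/negP => y0; apply: Sy; exact: subset_closure.
Qed.

Lemma test_function_supported k : ccontinuous_supported S (fun x => phi x 0 k).
Proof.
case: Gphi => sm _ _; have [s1 s2] := sm k.
have z x : ~ S x -> phi x = 0 by move=> /near_test_function0; exact: nbhs_singleton.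
split; split.
- by have [+ _] := s1 [::].
- by move=> x /z ->; rewrite mxE.
- by have [+ _] := s2 [::].
- by move=> x /z ->; rewrite mxE.
Qed.

Lemma partial_near0 j (f : R3 R -> R) x :
  (\forall y \near x, f y = 0) -> partial j f x = 0.
Proof.
move=> f0; rewrite /partial (@near_eq_derive _ _ _ f (cst 0)) ?derive_cst//.
Qed.

Lemma hpartial_supported j k : ccontinuous_supported S (fun x => hpartial j phi x 0 k).
Proof.
case: Gphi => sm _ _; have [s1 s2] := sm k; split; split.
- under eq_fun do rewrite mxE /=.
  (* [smooth] at the one-letter list [[:: j]] is the continuity of the partial derivative in
     direction [j]. *)
  by have [+ _] := s1 [:: j].
- move=> x Sx; rewrite mxE /=; apply: partial_near0.
  by apply: filterS (near_test_function0 Sx) => y; rewrite /re_part => ->; rewrite mxE.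
- under eq_fun do rewrite mxE /=.
  by have [+ _] := s2 [:: j].
- move=> x Sx; rewrite mxE /=; apply: partial_near0.
  by apply: filterS (near_test_function0 Sx) => y; rewrite /im_part => ->; rewrite mxE.
Qed.

Lemma Dop_supported k : ccontinuous_supported S (fun x => Dop phi x 0 k).
Proof.
under [X in ccontinuous_supported _ X]eq_fun do rewrite summxE.
apply: ccontinuous_supported_sum => j.
under [X in ccontinuous_supported _ X]eq_fun do rewrite hmul_coordE.
apply: ccontinuous_supported_sum => i; apply: ccontinuous_supported_sum => l.
(* Two constants are peeled off: the structure constant of the product, then the coordinate of
   [e_ R j]. *)
do 2! apply: ccontinuous_supportedZ; exact: hpartial_supported.
Qed.

End test_functions.

(** * Stability of the Vekua space under complex linear combinations *)

Section Vekua_subspace.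
Context (R : realType) (G : set (R3 R)) (A : 'I_4 -> R3 R -> HC R).
Hypothesis mG : measurable G.
Implicit Types u v w : R3 R -> HC R.

Lemma L2P u : L2 G u <-> forall k, csqintegrable G (fun x => u x 0 k).
Proof.
split=> [[mu fu] k|h]; first by apply/(csqintegrableP mG); split; [exact: mu|exact: fu].
by split=> k; have /(csqintegrableP mG)[] := h k.
Qed.

Lemma L2_linear (c : R[i]) u v : L2 G u -> L2 G v -> L2 G (fun x => c *: u x + v x).
Proof.
move=> /L2P hu /L2P hv; apply/L2P => k.
under [X in csqintegrable _ X]eq_fun do rewrite 2!mxE.
by apply: csqintegrableD => //; exact: csqintegrableZ.
Qed.

Lemma L1loc_linear (c : R[i]) u v :
  L1loc G u -> L1loc G v -> L1loc G (fun x => c *: u x + v x).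
Proof.
move=> [mu iu] [mv iv]; split=> [k|S cS SG k].
  suff : cmeasurable G (fun x => (c *: u x + v x) 0 k) by [].
  under [X in cmeasurable _ X]eq_fun do rewrite 2!mxE.
  by apply: cmeasurableD; [apply: cmeasurableZ; exact: mu|exact: mv].
have mS := compact_R3_measurable cS.
suff : cintegrable S (fun x => (c *: u x + v x) 0 k) by [].
under [X in cintegrable _ X]eq_fun do rewrite 2!mxE.
by apply: cintegrableD => //; [apply: cintegrableZ => //; exact: iu|exact: iv].
Qed.

(** The conjugation in [Qop] is the quaternionic one, which is complex linear, so [c] leaves all
    four terms without being conjugated. *)
Lemma Qop_linear (c : R[i]) u v x :
  Qop A (fun x => c *: u x + v x) x = c *: Qop A u x + Qop A v x.
Proof.
rewrite /Qop hconj_linear !hmul_linearl !hmul_linearr !scalerDr.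
by apply/rowP => k; rewrite ![in LHS]mxE ![in RHS]mxE; ring.
Qed.

Lemma hintegral_linear (c : R[i]) u v : hintegrable G u -> hintegrable G v ->
  hintegral G (fun x => c *: u x + v x) = c *: hintegral G u + hintegral G v.
Proof.
move=> ui vi; have ui' k : cintegrable G (fun x => u x 0 k) by exact: ui.
have vi' k : cintegrable G (fun x => v x 0 k) by exact: vi.
apply/rowP => k; rewrite !mxE -cintegralZ// -cintegralD//; last exact: cintegrableZ.
by apply: eq_cintegral => x _; rewrite !mxE.
Qed.

(** The integrals on the right converge because [psi] is supported in [S], so the integral may be
    split. It serves both sides of the weak equation, with [psi] equal to [Dop phi] and to [phi]. *)
Lemma hintegral_hmul_linear (c : R[i]) u v (psi : R3 R -> HC R) S : compact S -> S `<=` G ->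
  hintegrable S u -> hintegrable S v ->
  (forall j, ccontinuous_supported S (fun x => psi x 0 j)) ->
  hintegral G (fun x => hmul (hconj (c *: u x + v x)) (psi x)) =
  c *: hintegral G (fun x => hmul (hconj (u x)) (psi x)) +
  hintegral G (fun x => hmul (hconj (v x)) (psi x)).
Proof.
move=> cS SG ui vi hpsi; have mS := compact_R3_measurable cS.
(* Quaternionic conjugation only changes signs of coordinates. *)
have ci w : hintegrable S w -> hintegrable S (fun x => hconj (w x)).
  move=> wi k; suff : cintegrable S (fun x => hconj (w x) 0 k) by [].
  under [X in cintegrable _ X]eq_fun do rewrite hconj_coordE.
  by apply: cintegrableZ => //; exact: wi.
rewrite -hintegral_linear; last 2 first.
- by move=> k; apply: (cintegrable_hmul cS) => //; exact: ci.
- by move=> k; apply: (cintegrable_hmul cS) => //; exact: ci.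
by congr hintegral; apply/funext => x; rewrite hconj_linear hmul_linearl.
Qed.

Lemma weak_D_linear (c : R[i]) u u' v v' : weak_D G u u' -> weak_D G v v' ->
  weak_D G (fun x => c *: u x + v x) (fun x => c *: u' x + v' x).
Proof.
move=> [lu lu' eu] [lv lv' ev]; split; [by apply: L1loc_linear..|].
move=> phi tphi; have [_ cS SG] := tphi.
rewrite (hintegral_hmul_linear _ cS SG (lu.2 _ cS SG) (lv.2 _ cS SG)); last first.
  by move=> j; apply: (Dop_supported tphi).
rewrite (hintegral_hmul_linear _ cS SG (lu'.2 _ cS SG) (lv'.2 _ cS SG)); last first.
  by move=> j; apply: (test_function_supported tphi).
exact: (congr2 (fun p q => c *: p + q) (eu _ tphi) (ev _ tphi)).
Qed.

Lemma Vekua_space_linear (c : R[i]) u v :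
  Vekua_space G A u -> Vekua_space G A v -> Vekua_space G A (fun x => c *: u x + v x).
Proof.
move=> [Lu Du] [Lv Dv]; split; first exact: L2_linear.
have -> : Qop A (fun x => c *: u x + v x) = fun x => c *: Qop A u x + Qop A v x.
  by apply/funext => x; exact: Qop_linear.
exact: weak_D_linear.
Qed.

Lemma Vekua_space_sum n (a : 'I_n.+1 -> R[i]) (w : 'I_n.+1 -> R3 R -> HC R) :
  (forall j, Vekua_space G A (w j)) ->
  Vekua_space G A (fun x => \sum_j a j *: w j x).
Proof.
move=> hw; elim: (index_enum _) => [|j s IH].
  (* The zero function is obtained as [- w ord0 + w ord0]; this is why the index type is the
     nonempty ['I_n.+1]. *)
  have -> : (fun x => \sum_(j <- [::]) a j *: w j x) = fun x => -1 *: w ord0 x + w ord0 x.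
    by apply/funext => x; rewrite big_nil scaleN1r addNr.
  exact: Vekua_space_linear.
under [X in Vekua_space _ _ X]eq_fun do rewrite big_cons.
exact: (Vekua_space_linear (a j) (hw j) IH).
Qed.

End Vekua_subspace.

(** * The Hermitian inner product and almost everywhere equality *)

Section L2_inner_product.
Context (R : realType) (G : set (R3 R)).
Hypothesis mG : measurable G.
Implicit Types u v w : R3 R -> HC R.

Lemma cintegrable_hinner u v : L2 G u -> L2 G v ->
  cintegrable G (fun x => hinner (u x) (v x)).
Proof.
move=> /(L2P mG) hu /(L2P mG) hv; apply: cintegrable_sum => // k _.
by apply: csqintegrableM => //; exact: csqintegrable_conj.
Qed.

Lemma L2_inner_conj u v : L2 G u -> L2 G v ->
  L2_inner G u v = Num.conj (L2_inner G v u).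
Proof.
move=> hu hv; rewrite -cintegral_conj//; last exact: cintegrable_hinner.
apply: eq_cintegral => x _; rewrite rmorph_sum; apply: eq_bigr => k _.
by rewrite rmorphM /= conjCK mulrC.
Qed.

(** This allows an element of the Vekua space to be exchanged for its continuous representative
    under the inner product. *)
Lemma ae_eq_L2_inner u v w : L2 G u -> hmeasurable G v -> hmeasurable G w ->
  {ae @leb3 R, forall x, G x -> v x = w x} -> L2_inner G u v = L2_inner G u w.
Proof.
move=> [mu _] mv mw vw.
have mI t : hmeasurable G t -> cmeasurable G (fun x => hinner (u x) (t x)).
  move=> mt; rewrite /hinner; elim: (index_enum _) => [|k s IH].
    by under [X in cmeasurable _ X]eq_fun do rewrite big_nil; exact: cmeasurable_cst.
  under [X in cmeasurable _ X]eq_fun do rewrite big_cons.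
  by apply: cmeasurableD => //; apply: cmeasurableM; [apply: cmeasurable_conj; exact: mu|
    exact: mt].
apply: ae_eq_cintegral => //; [exact: mI..|].
by apply: filterS vw => x vw Gx; rewrite vw.
Qed.

Lemma L2_ae_eq v w : L2 G v -> hmeasurable G w ->
  {ae @leb3 R, forall x, G x -> v x = w x} -> L2 G w.
Proof.
move=> [mv fv] mw vw; split=> // k; move: (fv k); congr (_ < _)%E.
have m2 u : hmeasurable G u -> measurable_fun G (fun x => (Normc.normc (u x 0 k) ^+ 2)%:E).
  move=> mu; apply/measurable_EFinP; under eq_fun do rewrite sqr_normc.
  by apply: measurable_funD; apply: measurable_funX; have [] := mu k.
apply: ae_eq_integral => //; [exact: m2..|].
by apply: filterS vw => x vw Gx; rewrite vw.
Qed.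

End L2_inner_product.

(** * Hermitian symmetry of the kernel and the reproducing property *)

Lemma Riesz_kernel_conj (R : realType) (G : set (R3 R)) (A : 'I_4 -> R3 R -> HC R)
    (K : 'I_4 -> R3 R -> R3 R -> HC R) (x t : R3 R) (j k : 'I_4) :
  open G -> Riesz_kernels G A K -> G x -> G t ->
  K j t x 0 k = Num.conj (K k x t 0 j).
Proof.
move=> oG hK Gx Gt; have mG := open_R3_measurable oG.
have [Vx cx Ex] := hK k x Gx; have [Vt ct Et] := hK j t Gt.
(* Riesz kernels are taken continuous, so each is its own continuous representative and the
   reproducing identity of the other applies to its point values. *)
have refl (u : R3 R -> HC R) : hcontinuous G u -> continuous_rep G u u.
  by move=> cu; split=> //; exact: aeW.
rewrite (Ex _ _ Vt (refl _ ct)) (Et _ _ Vx (refl _ cx)).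
by apply: L2_inner_conj => //; [case: Vx|case: Vt].
Qed.

Theorem mainTheorem4 (R : realType) (G : set (R3 R)) (hG : Liapunov_domain G)
  (A : 'I_4 -> R3 R -> HC R) (hA : forall i, Linfty G (A i))
  (K : 'I_4 -> R3 R -> R3 R -> HC R) (hK : Riesz_kernels G A K) :
  (forall (t : R3 R) (a : HC R), G t ->
     Vekua_space G A (fun x => Vekua_Bergman_kernel K x t a)) /\
  (forall w W : R3 R -> HC R, Vekua_space G A w -> continuous_rep G w W ->
   forall x : R3 R, G x ->
     hintegrable G (fun t => Vekua_Bergman_kernel K x t (W t)) /\
     W x = hintegral G (fun t => Vekua_Bergman_kernel K x t (W t))).
Proof.
have oG : open G by case: hG => [[]].
have mG := open_R3_measurable oG.
split=> [t a Gt|w W Vw repW x Gx].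
  apply: (@Vekua_space_sum R G A mG 3 (fun j => a 0 j) (fun j => K j t)) => j.
  by have [] := hK j t Gt.
have [cW wW] := repW.
have mW : hmeasurable G W.
  by move=> k; split; apply: continuous_on_open_measurable => // y Gy; have [] := cW k y Gy.
(* The kernel formula uses the point values of [W], so square integrability is carried over from
   [w]. *)
have LW : L2 G W by apply: L2_ae_eq mW wW => //; case: Vw.
have LK k : L2 G (K k x) by have [[]] := hK k x Gx.
(* Symmetry swaps [x] and [t], turning the sum over [K j t x] with coefficients [W t 0 j] into the
   pairing with the single function [K k x]. *)
have kernelE k t : G t -> hinner (K k x t) (W t) = Vekua_Bergman_kernel K x t (W t) 0 k.
  move=> Gt; rewrite summxE; apply: eq_bigr => j _.
  by rewrite mxE (Riesz_kernel_conj _ _ oG hK Gx Gt) mulrC.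
split=> [k|].
  exact: (cintegrable_ext mG (kernelE k) (cintegrable_hinner mG (LK k) LW)).
apply/rowP => k; rewrite mxE -(eq_cintegral (kernelE k)).
have [_ _ Ex] := hK k x Gx; rewrite (Ex _ _ Vw repW).
(* The reproducing identity pairs [K k x] with [w], the integral pairs it with [W]; the two agree
   almost everywhere on [G]. *)
by apply: ae_eq_L2_inner => //; case: Vw => -[].
Qed.
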